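(* Let $k$ be a positive integer, $D$ a digraph, $v\in V(D)$, and let $R_v$ be the set of vertices reachable from $v$ by directed paths in $D$ (including $v$). Then either $\ell(D[R_v])\ge k$, or the underlying undirected graph of $D[R_v]$ has pathwidth at most $k^3$. Moreover, there is a polynomial-time algorithm which finds either an out-tree with at least $k$ leaves in $D[R_v]$, or a path decomposition of the underlying undirected graph of $D[R_v]$ of width at most $k^3$.
   Context: Digraphs are finite, without loops or parallel arcs. $D[S]$ denotes the subdigraph induced by a vertex set $S$. An out-tree of a digraph $D$ is a subdigraph $T$ that is an oriented tree with exactly one vertex of in-degree zero (the root); its leaves are its vertices of out-degree zero. $\ell(D)$ denotes the maximum number of leaves of an out-tree of $D$. The underlying undirected graph of a digraph is obtained by forgetting arc orientations and replacing each resulting pair of parallel edges by a single edge. A path decomposition of a graph $G$ is a sequence $(X_1,\dots,X_r)$ of subsets of $V(G)$ whose union is $V(G)$, such that every edge has both endpoints in some $X_i$, and for every vertex $u$ the indices $i$ with $u\in X_i$ form an interval; its width is $\max_i |X_i|-1$, and the pathwidth of $G$ is the minimum width of a path decomposition of $G$. *)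

(* Defs.v *)
From HB Require Import structures.
From mathcomp Require Import all_boot.
From mathcomp Require Import boolp.

Set Implicit Arguments.
Unset Strict Implicit.
Unset Printing Implicit Defensive.

(* Digraphs carry their vertex set as a subset of an ambient finite type, so   *)
(* that D[S] and all subdigraphs of D live in the same type as D. Arcs form a  *)
(* set of ordered pairs: parallel arcs are impossible, opposite arcs allowed.  *)
Definition wf_digraph (T : finType) (VA : {set T} * {set T * T}) : bool :=
  [forall a in VA.2, [&& a.1 \in VA.1, a.2 \in VA.1 & a.1 != a.2]].

Record digraph (T : finType) := Digraph {
  digraph_val : {set T} * {set T * T};
  digraph_wf : wf_digraph digraph_val }.

HB.instance Definition _ (T : finType) :=
  [isSub for (@digraph_val T)].
HB.instance Definition _ (T : finType) := [Finite of digraph T by <:].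

Definition dvert (T : finType) (D : digraph T) : {set T} := (digraph_val D).1.
Definition darcs (T : finType) (D : digraph T) : {set T * T} :=
  (digraph_val D).2.
Definition arc (T : finType) (D : digraph T) : rel T :=
  fun x y => (x, y) \in darcs D.

Definition subdigraph (T : finType) (H D : digraph T) : bool :=
  (dvert H \subset dvert D) && (darcs H \subset darcs D).

Definition indeg (T : finType) (D : digraph T) (x : T) : nat :=
  #|[set y | arc D y x]|.
Definition outdeg (T : finType) (D : digraph T) (x : T) : nat :=
  #|[set y | arc D x y]|.

Definition induced_val (T : finType) (D : digraph T) (S : {set T}) :
    {set T} * {set T * T} :=
  (dvert D :&: S, [set a in darcs D | (a.1 \in S) && (a.2 \in S)]).

Lemma induced_wf (T : finType) (D : digraph T) (S : {set T}) :
  wf_digraph (induced_val D S).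
Proof.
apply/forall_inP => a; rewrite !inE => /andP[aD /andP[-> ->]].
by have /forall_inP/(_ a aD)/and3P[-> -> ->] := digraph_wf D.
Qed.

Definition induced (T : finType) (D : digraph T) (S : {set T}) : digraph T :=
  Digraph (induced_wf D S).

Definition reach (T : finType) (D : digraph T) (v : T) : {set T} :=
  [set u | connect (arc D) v u].

Record ugraph (T : finType) := UGraph {
  uvert : {set T};
  uadj : rel T;
  uadj_sym : symmetric uadj;
  uadj_irr : irreflexive uadj;
  uadj_vert : forall x y, uadj x y -> x \in uvert }.

Definition und_adj (T : finType) (D : digraph T) : rel T :=
  fun x y => arc D x y || arc D y x.

Lemma und_adj_sym (T : finType) (D : digraph T) : symmetric (und_adj D).
Proof. by move=> x y; rewrite /und_adj orbC. Qed.

Lemma und_adj_irr (T : finType) (D : digraph T) : irreflexive (und_adj D).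
Proof.
move=> x; rewrite /und_adj orbb; apply/negP => xx.
by have /forall_inP/(_ _ xx)/and3P[_ _ /eqP] := digraph_wf D.
Qed.

Lemma und_adj_vert (T : finType) (D : digraph T) (x y : T) :
  und_adj D x y -> x \in dvert D.
Proof.
have /forall_inP wfD := digraph_wf D.
by case/orP => /wfD/and3P[].
Qed.

Definition underlying (T : finType) (D : digraph T) : ugraph T :=
  UGraph (@und_adj_sym T D) (@und_adj_irr T D) (@und_adj_vert T D).

(* [ucycle] means duplicate-free; since [uadj] is symmetric, every edge gives  *)
(* such a closed sequence of size 2, so genuine cycles are those of size >= 3. *)
Definition is_tree (T : finType) (G : ugraph T) : Prop :=
  [/\ uvert G != set0,
      {in uvert G &, forall x y, connect (uadj G) x y}
    & forall c : seq T, ucycle (uadj G) c -> size c <= 2].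

Definition oriented_tree (T : finType) (H : digraph T) : Prop :=
  is_tree (underlying H) /\ (forall x y, arc H x y -> ~~ arc H y x).

Definition out_tree (T : finType) (D H : digraph T) : Prop :=
  [/\ subdigraph H D, oriented_tree H
    & #|[set x in dvert H | indeg H x == 0]| = 1].

Definition leaves (T : finType) (H : digraph T) : {set T} :=
  [set x in dvert H | outdeg H x == 0].

Definition ell (T : finType) (D : digraph T) : nat :=
  \max_(H : digraph T | `[< out_tree D H >]) #|leaves H|.

Definition path_decomposition (T : finType) (G : ugraph T)
    (X : seq {set T}) : Prop :=
  [/\ \bigcup_(B <- X) B = uvert G,
      forall x y, uadj G x y -> exists2 B, B \in X & (x \in B) && (y \in B)
    & forall (u : T) (i j l : nat), i <= j <= l -> l < size X ->
        u \in nth set0 X i -> u \in nth set0 X l -> u \in nth set0 X j].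

(* The predecessor is truncated, which only matters for the graph without      *)
(* vertices.                                                                   *)
Definition pd_width (T : finType) (X : seq {set T}) : nat :=
  (\max_(B <- X) #|B|).-1.

Lemma ex_path_decomposition (T : finType) (G : ugraph T) :
  exists w, `[< exists2 X, path_decomposition G X & pd_width X = w >].
Proof.
exists (pd_width [:: uvert G]); apply/asboolP; exists [:: uvert G] => //.
split=> [|x y xy|u i j l /andP[_ jl]].
- by rewrite big_seq1.
- exists (uvert G); rewrite ?inE // (uadj_vert xy).
  by move: xy; rewrite uadj_sym => /uadj_vert.
- by rewrite /= ltnS leqn0 => /eqP l0; move: jl; rewrite l0 leqn0 => /eqP ->.
Qed.

Definition pathwidth (T : finType) (G : ugraph T) : nat :=
  ex_minn (ex_path_decomposition G).

(* Model of computation: structured programs for a random access machine over  *)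
(* the natural numbers, with finitely many registers and arrays per program,   *)
(* indirect addressing and unit cost for every operation. The arithmetic is    *)
(* limited to addition and (truncated) subtraction, so that values have at     *)
(* most linearly many bits in the running time and polynomial time is the same *)
(* as for Turing machines (S. Cook and R. Reckhow, 1973).                      *)
Inductive expr :=
| ECst of nat
| EReg of nat
| EGet of nat & expr
| EAdd of expr & expr
| ESub of expr & expr
| ELt of expr & expr
| EEq of expr & expr.

Inductive cmd :=
| CSkip
| CSet of nat & expr
| CPut of nat & expr & expr
| CSeq of cmd & cmd
| CIf of expr & cmd & cmd
| CWhile of expr & cmd.

Record store := Store { regs : nat -> nat; arrs : nat -> nat -> nat }.

Definition set_reg (s : store) (x m : nat) : store :=
  Store (fun y => if y == x then m else regs s y) (arrs s).
Definition set_arr (s : store) (a i m : nat) : store :=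
  Store (regs s)
    (fun b j => if (b == a) && (j == i) then m else arrs s b j).

Fixpoint eval (s : store) (e : expr) : nat :=
  match e with
  | ECst m => m
  | EReg x => regs s x
  | EGet a e => arrs s a (eval s e)
  | EAdd e f => eval s e + eval s f
  | ESub e f => eval s e - eval s f
  | ELt e f => eval s e < eval s f
  | EEq e f => eval s e == eval s f
  end.

Fixpoint ecost (e : expr) : nat :=
  match e with
  | ECst _ | EReg _ => 1
  | EGet _ e => (ecost e).+1
  | EAdd e f | ESub e f | ELt e f | EEq e f => (ecost e + ecost f).+1
  end.

(* [exec c s t s'] : started in [s], [c] halts after [t] steps in [s'].        *)
Inductive exec : cmd -> store -> nat -> store -> Prop :=
| ExSkip s : exec CSkip s 1 s
| ExSet x e s : exec (CSet x e) s (ecost e).+1 (set_reg s x (eval s e))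
| ExPut a e f s :
    exec (CPut a e f) s (ecost e + ecost f).+1
      (set_arr s a (eval s e) (eval s f))
| ExSeq c d s1 s2 s3 t u of exec c s1 t s2 & exec d s2 u s3 :
    exec (CSeq c d) s1 (t + u) s3
| ExIfTrue e c d s s' t of eval s e != 0 & exec c s t s' :
    exec (CIf e c d) s (ecost e + t).+1 s'
| ExIfFalse e c d s s' t of eval s e = 0 & exec d s t s' :
    exec (CIf e c d) s (ecost e + t).+1 s'
| ExWhileTrue e c s1 s2 s3 t u of
    eval s1 e != 0 & exec c s1 t s2 & exec (CWhile e c) s2 u s3 :
    exec (CWhile e c) s1 (ecost e + t + u).+1 s3
| ExWhileFalse e c s of eval s e = 0 :
    exec (CWhile e c) s (ecost e).+1 s.

(* The bound a * N ^ d is a polynomial bound since input sizes N are >= 1.     *)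
Definition solves_in_polytime (I : Type) (input_size : I -> nat)
    (input : I -> store) (correct : I -> store -> Prop) (c : cmd) : Prop :=
  exists a d : nat, forall i : I, exists (t : nat) (s : store),
    [/\ exec c (input i) t s, t <= a * input_size i ^ d & correct i s].

Record instance := Instance {
  inst_n : nat;
  inst_D : digraph 'I_inst_n;
  inst_full : dvert inst_D = setT;
  inst_v : 'I_inst_n;
  inst_k : nat;
  inst_kpos : 0 < inst_k }.

Definition bits (m : nat) : nat := (trunc_log 2 m).+1.

Definition inst_size (i : instance) : nat :=
  inst_n i * inst_n i + bits (inst_n i) + bits (inst_v i) + bits (inst_k i).

Definition arc_nat (n : nat) (D : digraph 'I_n) (x y : nat) : bool :=
  [exists u : 'I_n, exists w : 'I_n,
    [&& u == x :> nat, w == y :> nat & arc D u w]].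

(* Registers 0, 1, 2 hold n, v, k; array 0 holds the n x n adjacency matrix of *)
(* D row by row; all other cells are 0.                                        *)
Definition inst_store (i : instance) : store :=
  Store
    (nth 0 [:: inst_n i; nat_of_ord (inst_v i); inst_k i])
    (fun a j => if (a == 0) && (j < inst_n i * inst_n i)
       then nat_of_bool (arc_nat (inst_D i) (j %/ inst_n i) (j %% inst_n i))
       else 0).

(* Array 1: indicator of the vertex set; array 2: adjacency matrix.            *)
Definition holds_digraph (n : nat) (s : store) (H : digraph 'I_n) : Prop :=
  (forall u : 'I_n, arrs s 1 u = (u \in dvert H)) /\
  (forall u w : 'I_n, arrs s 2 (u * n + w) = arc H u w).

(* Register 1: number of bags; array 3: bag-vertex incidence matrix.           *)
Definition holds_bags (n : nat) (s : store) (X : seq {set 'I_n}) : Prop :=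
  regs s 1 = size X /\
  (forall (j : nat) (u : 'I_n), j < size X ->
     arrs s 3 (j * n + u) = (u \in nth set0 X j)).

(* Register 0 tells which of the two kinds of output has been produced.        *)
Definition inst_correct (i : instance) (s : store) : Prop :=
  let DR := induced (inst_D i) (reach (inst_D i) (inst_v i)) in
  (regs s 0 = 0 /\
   exists H, [/\ out_tree DR H, inst_k i <= #|leaves H|
               & holds_digraph s H])
  \/
  (regs s 0 = 1 /\
   exists X, [/\ path_decomposition (underlying DR) X,
                 pd_width X <= inst_k i ^ 3
               & holds_bags s X]).

(* Main.v *)
Require Import Defs.
From mathcomp Require Import all_boot boolp zify.
(* Restores [Defs.arc], which [path.arc] would shadow. *)
Import Defs.

(* Let lv be the breadth-first level of a vertex with respect to v. For a level *)
(* d let the bag of d consist of the levels d-1 and d and of all vertices of    *)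
(* smaller level that receive an arc from level d or beyond. An arc never skips *)
(* a level forwards, so these bags form a path decomposition. To bound them,    *)
(* grow an out-tree from a root u by expanding only vertices of a set B: all    *)
(* its vertices outside B are leaves. With u = v and B the first d levels, the  *)
(* leaves include the next level, so every level has less than k vertices, or   *)
(* we are done. With B the vertices of level at least lv u, the leaves include  *)
(* all heads, below level lv u, of arcs from vertices that u reaches within B.  *)
(* Every vertex of level at least d is reached like this from a vertex of level *)
(* d, so a bag has at most (k-1)^2 + 2(k-1) vertices. The algorithm runs these  *)
(* searches and outputs the first tree with k leaves, or the bags.              *)

Set Implicit Arguments.
Unset Strict Implicit.
Unset Printing Implicit Defensive.

(** * Search trees and levels *)

(** Both halves rest on one observation: in an out-tree grown from [u] by expanding only vertices of
    [B], every vertex outside [B] is a leaf ([search_tree_leaves]). So if no out-tree of D[R_v] has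
    k leaves, every such search ends with fewer than k vertices outside [B].

    Two families of searches are enough. From [v], with [B] a ball, the search fills exactly the
    next ball ([search_tree_ball]), which makes the next level small: [small_levels]. From each
    reachable [u], with [B] the levels from that of [u] on, few vertices of lower level are hit:
    [small_back_closure]. These two conditions alone bound the bags ([card_bag], [bags_width]), and
    the bags form a path decomposition in any case ([bags_path_decomposition]). [ell_or_pathwidth]
    combines these facts.

    The algorithm establishes the same two conditions by running the searches ([run_plevels],
    [run_pback]), unless one of them yields k vertices outside [B], hence a tree to output. It is
    written in a language with bounded loops only. Its programs have a functional semantics [run],
    which the compiled code realizes within a cost computed from the syntax ([exec_compile]), and
    that cost is polynomial for every program ([cost_poly]). *)

Lemma arc_vert (T : finType) (D : digraph T) (x y : T) :
  arc D x y -> [&& x \in dvert D, y \in dvert D & x != y].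
Proof. by move=> xy; have /forall_inP/(_ _ xy) := digraph_wf D. Qed.

Lemma arc_induced (T : finType) (D : digraph T) (S : {set T}) (x y : T) :
  arc (induced D S) x y = [&& arc D x y, x \in S & y \in S].
Proof. by rewrite /arc /darcs /= inE. Qed.

Lemma reach_arc (T : finType) (D : digraph T) (v x y : T) :
  x \in reach D v -> arc D x y -> y \in reach D v.
Proof. by rewrite !inE => vx xy; apply: connect_trans vx (connect1 xy). Qed.

Lemma reach_sub (T : finType) (D : digraph T) (v : T) :
  v \in dvert D -> reach D v \subset dvert D.
Proof.
move=> vD; apply/subsetP => x; rewrite inE => /connectP[p + ->].
by elim: p v vD => //= y p IHp v vD /andP[/arc_vert/and3P[_ yD _]]; apply: IHp.
Qed.

Lemma dvert_reach (T : finType) (D : digraph T) (v : T) :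
  v \in dvert D -> dvert (induced D (reach D v)) = reach D v.
Proof. by move=> /reach_sub/setIidPr. Qed.

Lemma arc_reach (T : finType) (D : digraph T) (v x y : T) :
  x \in reach D v -> arc (induced D (reach D v)) x y = arc D x y.
Proof.
move=> xR; rewrite arc_induced xR /=.
by case xy: (arc D x y); rewrite //= (reach_arc xR xy).
Qed.

(** * Out-trees grown one arc at a time *)

Lemma single_wf (T : finType) (u : T) : wf_digraph ([set u], set0).
Proof. by apply/forall_inP => a; rewrite inE. Qed.

Definition single (T : finType) (u : T) : digraph T := Digraph (single_wf u).

Lemma attach_wf (T : finType) (H : digraph T) (x y : T) :
  x \in dvert H -> y \notin dvert H ->
  wf_digraph (y |: dvert H, (x, y) |: darcs H).
Proof.
move=> xH yH; apply/forall_inP => -[a b]; rewrite !inE => /predU1P[[-> ->]|ab].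
  by rewrite xH eqxx orbT /=; apply: contraNneq yH => <-.
by case/and3P: (arc_vert ab) => -> -> ->; rewrite !orbT.
Qed.

Definition attach (T : finType) (H : digraph T) (x y : T)
    (xH : x \in dvert H) (yH : y \notin dvert H) : digraph T :=
  Digraph (attach_wf xH yH).

Section Attach.
Variables (T : finType) (H : digraph T) (x y : T).
Hypotheses (xH : x \in dvert H) (yH : y \notin dvert H).
Let H' := attach xH yH.

Lemma arc_attach a b : arc H' a b = ((a, b) == (x, y)) || arc H a b.
Proof. by rewrite /arc /darcs /= inE in_set1. Qed.

Let Hxy : (y == x) = false.
Proof. by apply/negbTE; apply: contraNneq yH => ->. Qed.

Let arcyF a : arc H a y = false.
Proof. by apply/negP => /arc_vert/and3P[_ yin _]; move: yH; rewrite yin. Qed.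

Let arcFy a : arc H y a = false.
Proof. by apply/negP => /arc_vert/and3P[yin]; move: yH; rewrite yin. Qed.

Lemma und_attach_new a : und_adj H' y a = (a == x).
Proof.
rewrite /und_adj !arc_attach arcFy arcyF !xpair_eqE eqxx Hxy.
by rewrite /= !orbF andbT.
Qed.

Lemma und_attach_old a b : a != y -> b != y -> und_adj H' a b = und_adj H a b.
Proof.
by move=> /negbTE ay /negbTE yb; rewrite /und_adj !arc_attach !xpair_eqE ay yb !andbF.
Qed.

(** The new vertex [y] is pendant. In a cycle of length at least 3 through [y], rotated to start
    there, both the second and the last vertex would be [x]; a cycle avoiding [y] lies in [H]. *)
Lemma attach_oriented : oriented_tree H -> oriented_tree H'.
Proof.
case=> -[_ conn cyc] asym; split; last first.
  move=> a b; rewrite !arc_attach => /predU1P[[-> ->]|ab].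
    by rewrite xpair_eqE Hxy /= arcFy.
  rewrite negb_or asym // andbT; apply: contraTneq ab => -[-> ->].
  by rewrite arcFy.
split.
- by apply/set0Pn; exists y; rewrite /= !inE eqxx.
- have sub : subrel (connect (und_adj H)) (connect (und_adj H')).
    apply: connect_sub => a b /orP ab; apply: connect1.
    by rewrite /und_adj !arc_attach; case: ab => ->; rewrite !orbT.
  have yx : connect (und_adj H') y x by apply: connect1; rewrite und_attach_new.
  have sym : connect_sym (und_adj H') by apply: sym_connect_sym; apply: und_adj_sym.
  have vx a : a \in dvert H' -> connect (und_adj H') a x.
    by rewrite !inE => /predU1P[-> //|aH]; apply: sub; apply: conn.
  by move=> a b /= /vx ax /vx; rewrite sym; apply: connect_trans.
- move=> c /andP[cc uc]; rewrite leqNgt; apply/negP => c3.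
  have [yc|yc] := boolP (y \in c).
    case: (rot_to yc) => i c' Ec.
    move: cc uc c3; rewrite -(rot_cycle i) -(rot_uniq i) -(size_rot i) Ec /=.
    case: c' {Ec} => [//|a c']; case/lastP: c' => [//|c' b] /=.
    rewrite rcons_path last_rcons rcons_path /= => /andP[ya /andP[_ by_]].
    move: by_; rewrite und_adj_sym und_attach_new => /eqP->.
    by move: ya; rewrite und_attach_new => /eqP->; rewrite mem_rcons inE eqxx andbF.
  have /cyc : ucycle (uadj (underlying H)) c.
    rewrite /ucycle uc andbT; move: cc.
    rewrite (@eq_in_cycle _ (predC1 y) _ (und_adj H)) //.
      by move=> a b; rewrite !inE /= => ay by_; rewrite und_attach_old.
    by apply/allP => a ac; rewrite !inE; apply: contraNneq yc => <-.
  by rewrite leqNgt c3.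
Qed.

(** The vertex [y] receives the arc from [x] and no other in-degree changes, so the set of roots
    stays the same. *)
Lemma attach_out_tree (D : digraph T) :
  out_tree D H -> arc D x y -> out_tree D H'.
Proof.
case=> /andP[sV sA] oH root1 xy; have /and3P[_ yD _] := arc_vert xy.
split.
  apply/andP; split; rewrite subUset sub1set ?yD ?sV // sA andbT.
  exact: xy.
  exact: attach_oriented.
rewrite -root1; apply: eq_card => z; rewrite !inE; have [->|zy] := eqVneq z y.
  rewrite (negbTE yH) /=; apply/negbTE; rewrite -lt0n; apply/card_gt0P; exists x.
  by rewrite inE arc_attach eqxx.
congr (_ && (_ == _)); apply: eq_card => a; rewrite !inE arc_attach xpair_eqE.
by rewrite (negbTE zy) andbF.
Qed.

End Attach.

Lemma single_out_tree (T : finType) (D : digraph T) (u : T) :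
  u \in dvert D -> out_tree D (single u).
Proof.
move=> uD; have arcF a b : arc (single u) a b = false by rewrite /arc inE.
split; first by rewrite /subdigraph sub1set uD sub0set.
  split; last by move=> x y; rewrite arcF.
  split; first by apply/set0Pn; exists u; rewrite inE.
    by move=> x y; rewrite !inE => /eqP-> /eqP->.
  case=> [//|x [//|y c]] /andP[/=].
  by rewrite {1}/und_adj !arcF.
rewrite (_ : [set _ in _ | _] = [set u]) ?cards1 //.
apply/setP => x; rewrite !inE; case: eqP => //= _.
by rewrite /indeg cards_eq0; apply/eqP/setP => y; rewrite !inE arcF.
Qed.

(* The out-trees obtained from [u] by a search that expands only vertices of [B]. *)
Definition search_tree (T : finType) (D : digraph T) (B : {set T}) (u : T)
    (H : digraph T) : Prop :=
  [/\ out_tree D H, u \in dvert H, forall x y, arc H x y -> x \in B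
    & forall y, y \in dvert H -> y = u \/ exists2 x, x \in B & arc D x y].

Lemma search_tree_single (T : finType) (D : digraph T) (B : {set T}) (u : T) :
  u \in dvert D -> search_tree D B u (single u).
Proof.
move=> uD; split; [exact: single_out_tree | by rewrite inE | |].
  by move=> x y; rewrite /arc inE.
by move=> y; rewrite inE => /eqP; left.
Qed.

Lemma search_tree_attach (T : finType) (D : digraph T) (B : {set T}) (u : T)
    (H : digraph T) (x y : T) (xH : x \in dvert H) (yH : y \notin dvert H) :
  search_tree D B u H -> x \in B -> arc D x y ->
  search_tree D B u (attach xH yH).
Proof.
move=> [oH uH tB inB] xB xy; split; first exact: attach_out_tree.
- by rewrite !inE uH orbT.
- by move=> a b; rewrite arc_attach => /predU1P[[-> _]|/tB].
- by move=> z; rewrite !inE => /predU1P[->|/inB //]; right; exists x.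
Qed.

(** All arcs of the tree start in [B], so a tree vertex outside [B] has out-degree zero. Every lower
    bound on leaves comes from here. *)
Lemma search_tree_leaves (T : finType) (D : digraph T) (B : {set T}) (u : T)
    (H : digraph T) :
  search_tree D B u H -> #|dvert H :\: B| <= #|leaves H|.
Proof.
case=> _ _ tB _; apply/subset_leq_card/subsetP => x; rewrite !inE => /andP[xB ->].
rewrite /outdeg cards_eq0; apply/eqP/setP => y; rewrite !inE; apply/negP => /tB.
by rewrite (negbTE xB).
Qed.

Definition search_closed (T : finType) (D : digraph T) (B W : {set T}) : Prop :=
  forall x y, x \in W -> x \in B -> arc D x y -> y \in W.

(** While some arc from a tree vertex in [B] leaves the tree, it can be attached; [m] bounds the
    number of vertices still missing. *)
Lemma ex_search_tree (T : finType) (D : digraph T) (B : {set T}) (u : T) :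
  u \in dvert D ->
  exists2 H, search_tree D B u H & search_closed D B (dvert H).
Proof.
move=> uD.
suff grow m H : search_tree D B u H -> #|T| <= #|dvert H| + m ->
    exists2 H, search_tree D B u H & search_closed D B (dvert H).
  exact: grow #|T| _ (search_tree_single B uD) (leq_addl _ _).
elim: m H => [|m IHm] H tH.
  rewrite addn0 => TH; exists H => // x y _ _ _.
  have /eqP-> : dvert H == setT by rewrite eqEcard subsetT cardsT.
  by rewrite inE.
move=> TH; have [/forall_inP cl|] := boolP [forall x in dvert H :&: B,
    [forall (y | arc D x y), y \in dvert H]].
  exists H => // x y xH xB xy; have /cl/forall_inP : x \in dvert H :&: B by rewrite inE xH.
  exact.
case/forall_inPn => x; rewrite inE => /andP[xH xB] /forall_inPn[y xy yH].
apply: (IHm _ (search_tree_attach xH yH tH xB xy)).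
by rewrite cardsU1 yH add1n addSnnS.
Qed.

(** * Breadth-first levels and the bags *)

Lemma in_bigcup_seq (T : finType) (X : seq {set T}) (y : T) :
  (y \in \bigcup_(B <- X) B) = has (fun B : {set T} => y \in B) X.
Proof. by elim: X => [|B X IHX]; rewrite ?big_nil ?big_cons /= inE ?IHX. Qed.

(** Starting from the empty set, the first iteration gives only [v], so [d] iterations give the
    vertices at distance less than [d]; hence the shift by one in [level]. The relation is a
    parameter because the searches also use arcs restricted to tails in [B]. *)
Definition out_step (T : finType) (e : rel T) (v : T) (X : {set T}) : {set T} :=
  v |: [set y | [exists x in X, e x y]].

Lemma out_step_mono (T : finType) (e : rel T) (v : T) :
  {homo out_step e v : X Y / X \subset Y}.
Proof.
move=> X Y /subsetP XY; apply/setUS/subsetP => y; rewrite !inE.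
by case/exists_inP => x /XY xY xy; apply/exists_inP; exists x.
Qed.

(* [level D v y] is the distance from [v] to [y] plus one, and 0 if [y] is not *)
(* reachable from [v].                                                         *)
Definition level (T : finType) (D : digraph T) (v : T) : T -> nat :=
  fix_order (out_step (arc D) v).

Section Levels.
Variables (T : finType) (D : digraph T) (v : T).
Local Notation lv := (level D v).
Local Notation step := (out_step (arc D) v).

Lemma in_ball (x : T) (d : nat) : (x \in iter d step set0) = (0 < lv x <= d).
Proof. exact: in_iter_fixE (@out_step_mono _ _ _) _ _. Qed.

Lemma level_ballD (d : nat) :
  iter d.+1 step set0 :\: iter d step set0 = [set y | lv y == d.+1].
Proof. by apply/setP => y; rewrite in_setD !in_ball inE; lia. Qed.

Lemma level_le_card (x : T) : lv x <= #|T|.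
Proof. exact: fix_order_le_max. Qed.

Lemma level_root : lv v = 1.
Proof.
have := in_ball v 1; rewrite !inE eqxx /= => /esym/andP[l0 l1].
by apply/eqP; rewrite eqn_leq l0 l1.
Qed.

Lemma level_arc (x y : T) : 0 < lv x -> arc D x y -> 0 < lv y <= (lv x).+1.
Proof.
move=> lx xy; rewrite -in_ball /= !inE; apply/orP; right.
by apply/exists_inP; exists x; rewrite // in_ball lx leqnn.
Qed.

(** Entering the balls at iteration [d.+2] requires an in-neighbour in the ball before; by
    [level_arc] that neighbour cannot have entered earlier. *)
Lemma level_pred (y : T) (d : nat) :
  lv y = d.+2 -> exists2 x, arc D x y & lv x = d.+1.
Proof.
move=> ly; have := in_ball y d.+2; rewrite ly leqnn /= !inE => /predU1P[yv|].
  by move: ly; rewrite yv level_root.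
case/exists_inP => x; rewrite -/(iter d.+1 step set0) in_ball => /andP[x0 xd] xy.
exists x => //; apply/eqP; rewrite eqn_leq xd /=.
by have := level_arc x0 xy; rewrite ly => /andP[].
Qed.

Lemma level_gt0 (y : T) : (0 < lv y) = (y \in reach D v).
Proof.
apply/idP/idP => [|].
  case E: (lv y) => [//|d] _; elim: d y E => [|d IHd] y E.
    have := in_ball y 1; rewrite E !inE /= => /predU1P[->//|].
    by case/exists_inP => x; rewrite inE.
  by case: (level_pred E) => x xy /IHd xR; apply: reach_arc xR xy.
rewrite inE => /connectP[p + ->]; have : 0 < lv v by rewrite level_root.
by elim: p {2 3 5}v => //= y' p IHp x x0 /andP[/(level_arc x0)/andP[y0 _]]; apply: IHp.
Qed.

(** This is the bag of level [d.+1]: the levels [d] and [d.+1], and the lower vertices that receive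
    an arc from level [d.+1] or beyond. Since unreachable vertices have level 0, [bag 0] must
    exclude that value explicitly. *)
Definition bag (d : nat) : {set T} :=
  [set y | [&& 0 < lv y, lv y <= d.+1
             & (d <= lv y) || [exists x, arc D x y && (d < lv x)]]].

Definition bags : seq {set T} := mkseq bag #|T|.

(** An edge lies in the bag of the larger of its two levels: an arc that does not go back stays in
    its level or climbs by one, and an arc going back puts its head in the bag of its tail. For the
    interval property, if level [j] is above [u], the arc that puts [u] into the later bag [l] also
    puts it into bag [j]. *)
Lemma bags_path_decomposition : v \in dvert D ->
  path_decomposition (underlying (induced D (reach D v))) bags.
Proof.
move=> vD; have nthB d : d < #|T| -> nth set0 bags d = bag d by exact: nth_mkseq.
have memB d : d < #|T| -> bag d \in bags.
  by move=> dT; rewrite -nthB // mem_nth // size_mkseq.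
split.
- rewrite /= dvert_reach //; apply/setP => y; rewrite -level_gt0.
  rewrite in_bigcup_seq; apply/hasP/idP => [[B /mapP[d _ ->]]|y0].
    by rewrite inE => /and3P[].
  exists (bag (lv y).-1); first by apply: memB; have := level_le_card y; lia.
  by rewrite inE y0 /=; apply/andP; split; last apply/orP; lia.
- have half x y : arc D x y -> 0 < lv x ->
      exists2 B, B \in bags & (x \in B) && (y \in B).
    move=> xy x0; have /andP[y0 yx] := level_arc x0 xy.
    have lx := level_le_card x; have ly := level_le_card y.
    exists (bag (maxn (lv x) (lv y)).-1); first by apply: memB; lia.
    rewrite !inE x0 y0 /=; apply/andP; split; apply/andP; split; try lia.
    have [xly|ylx] := leqP (lv x) (lv y); first by apply/orP; lia.
    by apply/orP; right; apply/existsP; exists x; rewrite xy; lia.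
  move=> x y /orP[]; rewrite arc_induced => /and3P[xy xR yR].
    by apply: half; rewrite ?level_gt0.
  by have [|B BX] := half _ _ xy; rewrite ?level_gt0 // andbC; exists B.
- move=> u i j l /andP[ij jl]; rewrite size_mkseq => lT.
  rewrite !nthB; try lia.
  rewrite !inE => /and3P[u0 ui _] /and3P[_ ul lu]; rewrite u0 /=.
  apply/andP; split; first lia.
  have [|jlu] := leqP j (lv u) => //=; case/orP: lu => [|]; first lia.
  by case/existsP => x /andP[xu lx]; apply/existsP; exists x; rewrite xu; lia.
Qed.

Definition small_levels (k m : nat) : Prop :=
  forall d, d < m -> #|[set y | lv y == d.+1]| < k.

(** The witness [W] may be any closed set, so the vertex set of the tree grown in the proof or by
    the program serves directly. *)
Definition small_back_closure (k : nat) (u : T) : Prop :=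
  let B := [set x | lv u <= lv x] in
  exists W : {set T}, [/\ u \in W, search_closed D B W & #|W :\: B| < k].

(** A vertex of the bag below level [d] is the head of an arc whose tail is reached from some [u] of
    level [d.+1] without dropping below that level, so it lies in [W u] outside [B]. There are at
    most [k.-1] such [u], each contributing at most [k.-1] vertices; the last two summands pay for
    the levels [d] and [d.+1]. *)
Lemma card_bag (k d : nat) : small_levels k #|T| ->
  (forall u, u \in reach D v -> small_back_closure k u) ->
  d < #|T| -> #|bag d| <= k.-1 * k.-1 + k.-1 + k.-1.
Proof.
move=> levk backk dT.
have levk' e : #|[set y | lv y == e.+1]| <= k.-1.
  have [/levk|Te] := ltnP e #|T|; first lia.
  rewrite (_ : [set y | _] = set0) ?cards0 //; apply/setP => y; rewrite !inE.
  have := level_le_card y; lia.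
have /fin_all_exists[W Wu] (u : T) : exists W : {set T}, u \in reach D v ->
    let B := [set x | lv u <= lv x] in
    [/\ u \in W, search_closed D B W & #|W :\: B| < k].
  have [/backk[W wW]|_] := boolP (u \in reach D v); [by exists W | by exists set0].
pose N u := W u :\: [set x | lv u <= lv x].
have sub : bag d \subset (\bigcup_(u in [set y | lv y == d.+1]) N u)
    :|: [set y | (0 < lv y) && (lv y == d)] :|: [set y | lv y == d.+1].
  apply/subsetP => y; rewrite !inE => /and3P[y0 yd].
  have [dy|yd' /= /existsP[x /andP[xy dx]]] := leqP d (lv y).
    by move=> _; rewrite y0 /=; lia.
  apply/orP; left; apply/orP; left.
  suff [u lu xW] : exists2 u, lv u = d.+1 & x \in W u.
    apply/bigcupP; exists u; first by rewrite inE lu.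
    have [|_ cl _] := Wu u; first by rewrite -level_gt0 lu.
    by rewrite !inE lu -ltnNge ltnS (ltnW yd') (cl _ _ xW) // inE lu.
  (* Descend from [x] through predecessors one level lower until level [d.+1]; the vertex [u] found
     there reaches [x] inside [B], so closedness carries membership in [W u] back up to [x]. *)
  elim: {y y0 yd yd' xy} _.+1 {-2}x (ltnSn (lv x)) dx => // m IHm x' xm dx.
  have [xd|xd] := eqVneq (lv x') d.+1.
    by exists x' => //; case: (Wu x'); rewrite -?level_gt0 ?xd.
  have [|z zx lz] := @level_pred x' (lv x').-2; first lia.
  have [|//|u lu zW] := IHm z; [lia|lia|]; exists u => //.
  have [|_ cl _] := Wu u; first by rewrite -level_gt0 lu.
  by apply: cl zW _ zx; rewrite inE lu; lia.
apply: leq_trans (subset_leq_card sub) _.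
apply: leq_trans (leq_card_setU _ _) _; apply: leq_add (levk' _).
apply: leq_trans (leq_card_setU _ _) _; apply: leq_add.
  apply: leq_trans (_ : \sum_(u in [set y | lv y == d.+1]) #|N u| <= _).
    elim/big_rec2: _ => [|u m A _ IH]; first by rewrite cards0.
    by apply: leq_trans (leq_card_setU _ _) _; rewrite leq_add2l.
  apply: leq_trans (_ : \sum_(u in [set y | lv y == d.+1]) k.-1 <= _).
    apply: leq_sum => u; rewrite inE => /eqP lu.
    have [|_ _] := Wu u; first by rewrite -level_gt0 lu.
    by rewrite -/(N u); lia.
  by rewrite sum_nat_const leq_mul2r levk' orbT.
(* For [d = 0] the second set is empty, since level 0 holds the unreachable vertices. *)
case: d {dT sub} => [|d].
  by rewrite (_ : [set y | _] = set0) ?cards0 //; apply/setP => y; rewrite !inE; lia.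
apply: leq_trans (levk' d); apply/subset_leq_card/subsetP => y.
by rewrite !inE => /andP[].
Qed.

Lemma bags_width (k : nat) : small_levels k #|T| ->
  (forall u, u \in reach D v -> small_back_closure k u) ->
  pd_width bags <= k ^ 3.
Proof.
move=> levk backk; apply: (leq_trans (leq_pred _)).
apply/bigmax_leqP_seq => B /mapP[d]; rewrite mem_iota => /= dT -> _.
(* For positive [k] the bound equals [k ^ 2 - 1]; for [k = 0] it is 0. *)
apply: leq_trans (card_bag levk backk dT) _; rewrite !expnS expn0 muln1; nia.
Qed.

End Levels.

(** * Searches inside the reachable set: many leaves or small pathwidth *)

Section ReachSearch.
Variables (T : finType) (D : digraph T) (v : T).
Hypothesis vD : v \in dvert D.
Local Notation DR := (induced D (reach D v)).
Local Notation ball d := (iter d (out_step (arc D) v) set0).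

Lemma root_in_reach : v \in reach D v.
Proof. by rewrite inE. Qed.

Lemma search_tree_sub_reach (B : {set T}) (u : T) (H : digraph T) :
  search_tree DR B u H -> dvert H \subset reach D v.
Proof. by case=> -[/andP[+ _] _ _] _ _ _; rewrite dvert_reach. Qed.

Lemma search_closed_reach (B W : {set T}) : W \subset reach D v ->
  search_closed DR B W -> search_closed D B W.
Proof.
by move=> /subsetP WR cl x y xW xB xy; apply: cl (xW) xB _; rewrite arc_reach ?WR.
Qed.

(** Each tree vertex other than [v] has an in-neighbour in the [d]-ball, which gives one inclusion;
    the other follows by induction on the balls, all of which up to the [d]-th consist of expandable
    vertices. *)
Lemma search_tree_ball (d : nat) (H : digraph T) :
  search_tree DR (ball d) v H -> search_closed D (ball d) (dvert H) ->
  dvert H = ball d.+1.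
Proof.
case=> _ vH _ inB cl; apply/eqP; rewrite eqEsubset; apply/andP; split.
  apply/subsetP => y /inB[->|[x xB]]; first by rewrite /= !inE eqxx.
  rewrite arc_induced => /and3P[xy _ _]; rewrite /= !inE.
  by apply/orP; right; apply/exists_inP; exists x.
suff sub e : e <= d -> ball e.+1 \subset dvert H by exact: sub.
elim: e => [_|e IHe ed].
  by apply/subsetP => y; rewrite !inE => /predU1P[-> //|/exists_inP[x]]; rewrite inE.
apply/subsetP => y; rewrite -[iter _ _ _]/(out_step (arc D) v (ball e.+1)) !in_setU1 inE.
case/predU1P=> [-> //|/exists_inP[x xe]].
apply: cl; first by apply: (subsetP (IHe (ltnW ed))).
by apply: subsetP xe; apply: subset_iter ed; apply: out_step_mono.
Qed.

Lemma ell_or_pathwidth (k : nat) :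
  k <= ell DR \/ pathwidth (underlying DR) <= k ^ 3.
Proof.
have [|ellk] := leqP k (ell DR); [by left | right].
have small B u H : search_tree DR B u H -> #|dvert H :\: B| < k.
  move=> tH; apply: leq_ltn_trans (search_tree_leaves tH) (leq_ltn_trans _ ellk).
  by case: tH => oH _ _ _; apply: leq_bigmax_cond; apply/asboolP.
have ex B u : u \in reach D v ->
    exists2 H, search_tree DR B u H & search_closed D B (dvert H).
  rewrite -{1}(dvert_reach vD) => /(ex_search_tree B)[H tH cl]; exists H => //.
  exact: search_closed_reach (search_tree_sub_reach tH) cl.
apply: leq_trans (_ : pd_width (bags D v) <= _).
  rewrite /pathwidth; case: ex_minnP => w _; apply; apply/asboolP.
  by exists (bags D v) => //; apply: bags_path_decomposition.
apply: bags_width => [d _|u uR].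
  have [H tH cl] := ex (ball d) v root_in_reach.
  by rewrite -level_ballD -(search_tree_ball tH cl); apply: small tH.
have [H tH cl] := ex [set x | level D v u <= level D v x] u uR.
by exists (dvert H); split; [case: tH | | apply: small tH].
Qed.

End ReachSearch.

(** * Bounded-loop programs *)

(* Programs whose only loops run a counter register from 0 up to the value of  *)
(* register 0.                                                                 *)
Inductive prog :=
| PSkip
| PSet of nat & expr
| PPut of nat & expr & expr
| PSeq of prog & prog
| PIf of expr & prog & prog
| PFor of nat & prog.

Fixpoint compile (p : prog) : cmd :=
  match p with
  | PSkip => CSkip
  | PSet x e => CSet x e
  | PPut a e f => CPut a e f
  | PSeq p q => CSeq (compile p) (compile q)
  | PIf e p q => CIf e (compile p) (compile q)
  | PFor x p =>
      CSeq (CSet x (ECst 0))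
        (CWhile (ELt (EReg x) (EReg 0))
           (CSeq (compile p) (CSet x (EAdd (EReg x) (ECst 1)))))
  end.

(** The number of iterations of [PFor] is fixed on entry. This agrees with the compiled while loop
    when the body writes neither the counter nor register 0, as [wf_loops] demands. *)
Fixpoint run (p : prog) (s : store) : store :=
  match p with
  | PSkip => s
  | PSet x e => set_reg s x (eval s e)
  | PPut a e f => set_arr s a (eval s e) (eval s f)
  | PSeq p q => run q (run p s)
  | PIf e p q => if eval s e != 0 then run p s else run q s
  | PFor x p =>
      iter (regs s 0)
        (fun s' => set_reg (run p s') x (regs (run p s') x + 1))
        (set_reg s x 0)
  end.

Fixpoint wregs (p : prog) : seq nat :=
  match p with
  | PSkip | PPut _ _ _ => [::]
  | PSet x _ => [:: x]
  | PSeq p q | PIf _ p q => wregs p ++ wregs q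
  | PFor x p => x :: wregs p
  end.

Fixpoint warrs (p : prog) : seq nat :=
  match p with
  | PSkip | PSet _ _ => [::]
  | PPut a _ _ => [:: a]
  | PSeq p q | PIf _ p q => warrs p ++ warrs q
  | PFor _ p => warrs p
  end.

Fixpoint wf_loops (p : prog) : bool :=
  match p with
  | PSeq p q | PIf _ p q => wf_loops p && wf_loops q
  | PFor x p => [&& x != 0, x \notin wregs p, 0 \notin wregs p & wf_loops p]
  | _ => true
  end.

(** Here [n] is the content of register 0. In a loop, 8 pays for one test and one increment, and 6
    for the initialization and the final failing test; a conditional is charged for both
    branches. *)
Fixpoint cost (p : prog) (n : nat) : nat :=
  match p with
  | PSkip => 1
  | PSet _ e => (ecost e).+1
  | PPut _ e f => (ecost e + ecost f).+1
  | PSeq p q => cost p n + cost q n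
  | PIf e p q => (ecost e + (cost p n + cost q n)).+1
  | PFor _ p => n * (cost p n + 8) + 6
  end.

(** With the syntactic write sets [wregs] and [warrs], the claim that a given cell survives a
    program reduces to a computation; this is the source of the many [isT] arguments below. *)
Definition frame (R A : seq nat) (s s' : store) : Prop :=
  (forall r, r \notin R -> regs s' r = regs s r) /\
  (forall a j, a \notin A -> arrs s' a j = arrs s a j).

Lemma frame_refl (R A : seq nat) (s : store) : frame R A s s.
Proof. by []. Qed.

Lemma frame_trans (R A : seq nat) (s1 s2 s3 : store) :
  frame R A s1 s2 -> frame R A s2 s3 -> frame R A s1 s3.
Proof.
move=> [r12 a12] [r23 a23]; split=> [r rR|a j aA]; first by rewrite r23 // r12.
by rewrite a23 // a12.
Qed.

Lemma frame_sub (R A R' A' : seq nat) (s s' : store) :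
  {subset R <= R'} -> {subset A <= A'} -> frame R A s s' -> frame R' A' s s'.
Proof.
move=> RR AA [fr fa]; split=> [r rR|a j aA].
  by apply: fr; apply: contra rR; apply: RR.
by apply: fa; apply: contra aA; apply: AA.
Qed.

Lemma frame_set_reg (R A : seq nat) (s : store) (x m : nat) :
  x \in R -> frame R A s (set_reg s x m).
Proof. by move=> xR; split=> //= r; case: eqP => // ->; rewrite xR. Qed.

Lemma frame_set_arr (R A : seq nat) (s : store) (a i m : nat) :
  a \in A -> frame R A s (set_arr s a i m).
Proof. by move=> aA; split=> //= b j; case: eqP => //= ->; rewrite aA. Qed.

Lemma frame_run (p : prog) (s : store) : frame (wregs p) (warrs p) s (run p s).
Proof.
elim: p s => [|x e|a e f|p IHp q IHq|e p IHp q IHq|x p IHp] s /=.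
- exact: frame_refl.
- by apply: frame_set_reg; rewrite inE.
- by apply: frame_set_arr; rewrite inE.
- apply: (@frame_trans _ _ _ (run p s)).
    by apply: frame_sub (IHp s) => r; rewrite mem_cat => ->.
  by apply: frame_sub (IHq _) => r; rewrite mem_cat => ->; rewrite orbT.
- case: ifP => _; last by apply: frame_sub (IHq s) => r; rewrite mem_cat => ->; rewrite orbT.
  by apply: frame_sub (IHp s) => r; rewrite mem_cat => ->.
- elim: (regs s 0) => [|m IHm] /=; first by apply: frame_set_reg; rewrite inE eqxx.
  apply: frame_trans IHm _; set s' := iter _ _ _.
  apply: (@frame_trans _ _ _ (run p s')); last by apply: frame_set_reg; rewrite inE eqxx.
  by apply: frame_sub (IHp s') => // r; rewrite inE => ->; rewrite orbT.
Qed.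

(** The invariant rule for loops. The frame relative to the initial store lets the step read
    whatever the loop does not modify, so invariants mention only the cells that change. *)
Lemma run_for_ind (x : nat) (p : prog) (s : store) (P : nat -> store -> Prop) :
  wf_loops (PFor x p) -> P 0 (set_reg s x 0) ->
  (forall i s', i < regs s 0 -> regs s' x = i ->
     frame (x :: wregs p) (warrs p) s s' -> P i s' ->
     P i.+1 (set_reg (run p s') x i.+1)) ->
  P (regs s 0) (run (PFor x p) s).
Proof.
move=> /and4P[x0 xp p0 wfp] P0 Pstep /=.
set body := fun s' => set_reg _ _ _.
suff it i : i <= regs s 0 -> let s' := iter i body (set_reg s x 0) in
    [/\ regs s' x = i, frame (x :: wregs p) (warrs p) s s' & P i s'].
  by case: (it _ (leqnn _)).
elim: i => [_|i IHi ilt] /=.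
  by rewrite eqxx; split=> //; apply: frame_set_reg; rewrite inE eqxx.
set s' := iter i _ _ in IHi *; have [xi fr Pi] := IHi (ltnW ilt).
have Exi : regs (run p s') x + 1 = i.+1 by rewrite (frame_run p s').1 // xi addn1.
rewrite /body Exi /= eqxx; split=> //; last exact: Pstep.
apply: frame_trans fr _; apply: (@frame_trans _ _ _ (run p s')).
  by apply: frame_sub (frame_run p s') => // r; rewrite inE => ->; rewrite orbT.
by apply: frame_set_reg; rewrite inE eqxx.
Qed.

Lemma exec_compile (p : prog) (s : store) : wf_loops p -> 0 \notin wregs p ->
  exists2 t, exec (compile p) s t (run p s) & t <= cost p (regs s 0).
Proof.
elim: p s => [|x e|a e f|p IHp q IHq|e p IHp q IHq|x p IHp] s /=.
- by exists 1; first constructor.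
- by eexists; first constructor.
- by eexists; first constructor.
- rewrite mem_cat negb_or => /andP[/IHp {}IHp /IHq {}IHq] /andP[p0 /IHq {}IHq].
  have [t ext le_t] := IHp s p0; have [u exu] := IHq (run p s).
  rewrite (frame_run p s).1 // => le_u.
  by exists (t + u); [apply: ExSeq exu | rewrite leq_add].
- rewrite mem_cat negb_or => /andP[/IHp {}IHp /IHq {}IHq] /andP[/IHp {}IHp /IHq {}IHq].
  case: ifP => [e1|/negbFE/eqP e0].
    have [t ext le_t] := IHp s; exists (ecost e + t).+1; first exact: ExIfTrue.
    by rewrite ltnS leq_add2l (leq_trans le_t) ?leq_addr.
  have [t ext le_t] := IHq s; exists (ecost e + t).+1; first exact: ExIfFalse.
  by rewrite ltnS leq_add2l (leq_trans le_t) ?leq_addl.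
- move=> /and4P[x0 xp p0 wfp] _; set e := ELt _ _; set c := CSeq (compile p) _.
  set body := fun s' => set_reg _ _ _.
  have body_frame s' : regs (body s') 0 = regs s' 0.
    by rewrite /= eq_sym (negbTE x0) (frame_run p s').1.
  (* Here [m] is the number of iterations left. *)
  have loop m s' : regs s' 0 = regs s' x + m -> exists2 t,
      exec (CWhile e c) s' t (iter m body s') & t <= m * (cost p (regs s' 0) + 8) + 4.
    elim: m s' => [|m IHm] s' Em.
      by exists (ecost e).+1 => //; apply: ExWhileFalse; rewrite /= Em addn0 ltnn.
    have [t ext le_t] := IHp s' wfp p0.
    have [|u exu] := IHm (body s').
      by rewrite body_frame Em /= eqxx (frame_run p s').1 // addnAC addn1 addnS.
    rewrite body_frame => le_u; exists (ecost e + (t + 4) + u).+1.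
      rewrite iterSr; apply: ExWhileTrue exu.
        by rewrite /= Em -[X in X < _]addn0 ltn_add2l.
      by apply: ExSeq ext _; apply: (ExSet x (EAdd (EReg x) (ECst 1))).
    by rewrite mulSn /=; lia.
  have [|t ext le_t] := loop (regs s 0) (set_reg s x 0).
    by rewrite /= eqxx eq_sym (negbTE x0).
  exists (2 + t); first by apply: ExSeq ext; apply: (ExSet x (ECst 0)).
  by move: le_t; rewrite /= eq_sym (negbTE x0); lia.
Qed.

Lemma cost_poly (p : prog) :
  exists a d, forall n, 0 < n -> cost p n <= a * n ^ d.
Proof.
have add a d b e n : 0 < n -> a * n ^ d + b * n ^ e <= (a + b) * n ^ (d + e).
  move=> n0; rewrite mulnDl leq_add // leq_mul2l leq_pexp2l ?orbT ?leq_addr ?leq_addl //.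
elim: p => [|x e|a e f|p IHp q IHq|e p IHp q IHq|x p IHp] /=.
- by exists 1, 0.
- by exists (ecost e).+1, 0 => n _; rewrite muln1.
- by exists (ecost e + ecost f).+1, 0 => n _; rewrite muln1.
- case: IHp IHq => [a [d pd]] [b [e qe]]; exists (a + b), (d + e) => n n0.
  exact: leq_trans (leq_add (pd n n0) (qe n n0)) (add _ _ _ _ _ n0).
- case: IHp IHq => [a [d pd]] [b [e' qe]].
  exists ((ecost e).+1 + (a + b)), (d + e') => n n0; rewrite -addSn mulnDl leq_add //.
    by rewrite leq_pmulr // expn_gt0 n0.
  exact: leq_trans (leq_add (pd n n0) (qe n n0)) (add _ _ _ _ _ n0).
(* The constants 8 and 6 of the loop cost are absorbed by [14 * n ^ d.+1]. *)
- case: IHp => [a [d pd]]; exists (a + 14), d.+1 => n n0.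
  have nd : 0 < n ^ d by rewrite expn_gt0 n0.
  have := pd n n0; rewrite expnS; move: (n ^ d) nd (cost p n) => m m0 c cm; nia.
Qed.

(** * The algorithm *)

Local Notation rn := 0 (only parsing).
Local Notation rv := 1 (only parsing).
Local Notation rk := 2 (only parsing).
Local Notation rfound := 3 (only parsing).
Local Notation rroot := 4 (only parsing).
Local Notation rround := 5 (only parsing).
Local Notation rx := 6 (only parsing).
Local Notation ry := 7 (only parsing).
Local Notation rcount := 8 (only parsing).
Local Notation rd := 9 (only parsing).
Local Notation racc := 10 (only parsing).
Local Notation aadj := 0 (only parsing).
Local Notation avert := 1 (only parsing).
Local Notation aarc := 2 (only parsing).
Local Notation abag := 3 (only parsing).
Local Notation arow := 4 (only parsing).
Local Notation aB := 5 (only parsing).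
Local Notation alev := 6 (only parsing).

Definition cell (x y : nat) : expr := EAdd (EGet arow (EReg x)) (EReg y).

(* Multiples of n, as the machine cannot multiply. *)
Definition prows : prog :=
  PSeq (PSet racc (ECst 0))
    (PFor rx (PSeq (PPut arow (EReg rx) (EReg racc))
                   (PSet racc (EAdd (EReg racc) (EReg rn))))).

Definition pclear : prog :=
  PFor rx (PSeq (PPut avert (EReg rx) (ECst 0))
                (PFor ry (PPut aarc (cell rx ry) (ECst 0)))).

Definition pattach : prog :=
  PIf (EGet avert (EReg rx))
    (PIf (EGet aB (EReg rx))
      (PIf (EGet aadj (cell rx ry))
        (PIf (EGet avert (EReg ry)) PSkip
          (PSeq (PPut avert (EReg ry) (ECst 1))
                (PPut aarc (cell rx ry) (ECst 1))))
        PSkip) PSkip) PSkip.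

Definition pgrow : prog :=
  PSeq pclear
    (PSeq (PPut avert (EReg rroot) (ECst 1))
      (PFor rround (PFor rx (PFor ry pattach)))).

Definition pcount : prog :=
  PSeq (PSet rcount (ECst 0))
    (PFor ry (PIf (EGet avert (EReg ry))
      (PIf (EGet aB (EReg ry)) PSkip
        (PSet rcount (EAdd (EReg rcount) (ECst 1)))) PSkip)).

(* [root] and [allowed] select the search tree, and [next] runs if it has less *)
(* than k vertices outside [allowed].                                          *)
Definition ptry (root allowed : expr) (next : prog) : prog :=
  PSeq (PSet rroot root)
    (PSeq (PFor rx (PPut aB (EReg rx) allowed))
      (PSeq pgrow (PSeq pcount
        (PIf (ELt (EReg rcount) (EReg rk)) next (PSet rfound (ECst 1)))))).

Definition plabel : prog :=
  PFor ry (PIf (EGet avert (EReg ry))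
    (PIf (EGet alev (EReg ry)) PSkip
      (PPut alev (EReg ry) (EAdd (EReg rd) (ECst 1)))) PSkip).

(** In round [d] exactly the vertices of level 1 to [d] carry a positive label, so they are the
    expandable set; the tree then fills the next ball, and its unlabelled vertices are those of
    level [d.+1]. *)
Definition plevels : prog :=
  PFor rd (PIf (EReg rfound) PSkip
    (ptry (EReg rv) (ELt (ECst 0) (EGet alev (EReg rx))) plabel)).

Definition pback : prog :=
  PFor rd (PIf (EReg rfound) PSkip
    (PIf (EGet alev (EReg rd))
      (ptry (EReg rd)
         (ELt (EGet alev (EReg rd)) (EAdd (EGet alev (EReg rx)) (ECst 1)))
         PSkip)
      PSkip)).

(** A conjunction of three truth values is tested as their sum exceeding 2, and a comparison with
    [<=] becomes [<] by adding one on the right. *)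
Definition pbag_entry : prog :=
  PSeq (PSet racc (ELt (EReg rd) (EAdd (EGet alev (EReg ry)) (ECst 1))))
    (PSeq (PFor rx (PIf (EGet aadj (cell rx ry))
                     (PIf (ELt (EReg rd) (EGet alev (EReg rx)))
                        (PSet racc (ECst 1)) PSkip) PSkip))
      (PPut abag (cell rd ry)
        (ELt (ECst 2)
          (EAdd (EAdd (ELt (ECst 0) (EGet alev (EReg ry)))
                      (ELt (EGet alev (EReg ry)) (EAdd (EReg rd) (ECst 2))))
                (EReg racc))))).

Definition pbags : prog := PFor rd (PFor ry pbag_entry).

Definition pmain : prog := PSeq prows (PSeq plevels (PSeq pback pbags)).

(** Register 0 holds n until the end, so the number of bags is copied from it before it is
    overwritten by the kind of output: 0 for a tree, 1 for bags. *)
Definition leaf_or_path : cmd :=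
  CSeq (compile pmain)
    (CSeq (CSet 1 (EReg rn)) (CSet 0 (ESub (ECst 1) (EReg rfound)))).

(** * Correctness of the program *)

Lemma cell_inj (n x x' y y' : nat) : y < n -> y' < n ->
  (x * n + y == x' * n + y') = (x == x') && (y == y').
Proof.
move=> yn y'n; apply/eqP/andP => [E|[/eqP-> /eqP->] //].
have n0 : 0 < n by apply: leq_ltn_trans yn.
have := congr1 (divn^~ n) E; rewrite !divnMDl // !divn_small // !addn0 => xx.
by move: E; rewrite xx => /addnI ->.
Qed.

Lemma nat_bool_neq0 (b : bool) : ((b : nat) != 0) = b.
Proof. by case: b. Qed.

Lemma run_skipE (s : store) : run PSkip s = s.
Proof. by []. Qed.

Lemma run_setE (x : nat) (e : expr) (s : store) :
  run (PSet x e) s = set_reg s x (eval s e).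
Proof. by []. Qed.

Lemma run_putE (a : nat) (e f : expr) (s : store) :
  run (PPut a e f) s = set_arr s a (eval s e) (eval s f).
Proof. by []. Qed.

Lemma run_seqE (p q : prog) (s : store) : run (PSeq p q) s = run q (run p s).
Proof. by []. Qed.

Lemma run_ifE (e : expr) (p q : prog) (s : store) :
  run (PIf e p q) s = if eval s e != 0 then run p s else run q s.
Proof. by []. Qed.

Definition runE := (run_skipE, run_setE, run_putE, run_seqE, run_ifE).

Arguments run : simpl never.

Lemma run_fill (a x : nat) (e : expr) (Q : nat -> nat -> Prop) (s : store) :
  x != 0 ->
  (forall i s', i < regs s 0 -> regs s' x = i -> frame [:: x] [:: a] s s' ->
     Q i (eval s' e)) ->
  forall i, i < regs s 0 -> Q i (arrs (run (PFor x (PPut a (EReg x) e)) s) a i).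
Proof.
move=> x0 Qe.
apply: (@run_for_ind x _ s (fun m s' => forall i, i < m -> Q i (arrs s' a i))) => //.
  by rewrite /= x0.
move=> m s' mn xm fr IH i im; rewrite runE /= eqxx /= xm.
by case: eqP => [->|/eqP im']; [exact: Qe | apply: IH; lia].
Qed.

Section Program.
Variables (n : nat) (D : digraph 'I_n) (v : 'I_n) (k : nat).
Hypothesis vD : v \in dvert D.
Local Notation DR := (induced D (reach D v)).
Local Notation lv := (level D v).

Definition env (s : store) : Prop :=
  [/\ regs s rn = n,
      forall x y : 'I_n, arrs s aadj (x * n + y) = arc D x y
    & forall x : nat, x < n -> arrs s arow x = x * n].

Lemma env_frame (R A : seq nat) (s s' : store) :
  frame R A s s' -> rn \notin R -> aadj \notin A -> arow \notin A ->
  env s -> env s'.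
Proof.
move=> [fr fa] nR aA rA [sn sa sr]; split=> [|x y|x xn]; first by rewrite fr.
  by rewrite fa.
by rewrite fa // sr.
Qed.

Lemma run_prows (s : store) : regs s rn = n ->
  forall x, x < n -> arrs (run prows s) arow x = x * n.
Proof.
move=> sn; rewrite /prows !runE; set s0 := set_reg _ _ _.
have s0n : regs s0 rn = n by [].
pose P i s' := regs s' racc = i * n /\
  forall x, x < i -> arrs s' arow x = x * n.
have : P (regs s0 rn) (run (PFor rx (PSeq (PPut arow (EReg rx) (EReg racc))
                   (PSet racc (EAdd (EReg racc) (EReg rn))))) s0).
  apply: run_for_ind => // i s' ilt xi fr [acc IH].
  rewrite /P !runE /= acc (fr.1 rn isT) s0n mulSn addnC; split=> // x; rewrite ltnS leq_eqVlt xi.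
  by case: eqP => //= [-> //|_ /IH].
by rewrite s0n => -[].
Qed.

Lemma run_pclear (s : store) : env s ->
  (forall x : 'I_n, arrs (run pclear s) avert x = 0) /\
  (forall x y : 'I_n, arrs (run pclear s) aarc (x * n + y) = 0).
Proof.
move=> es; have [sn _ _] := es.
pose P i s' := forall x : 'I_n, x < i -> arrs s' avert x = 0 /\
  forall y : 'I_n, arrs s' aarc (x * n + y) = 0.
have : P (regs s rn) (run pclear s).
  apply: run_for_ind => // i s' ilt xi fr IH.
  rewrite !runE [eval _ (EReg _)]/= xi.
  set s1 := set_arr _ _ _ _; set p := PFor _ _.
  have e1 : env s1.
    apply: (env_frame (@frame_set_arr [::] [:: avert] _ _ _ _ _)) => //.
    exact: env_frame fr _ _ _ es.
  have [s1n _ s1r] := e1.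
  pose Q j s' := forall x y : 'I_n, (x < i) || (x == i :> nat) && (y < j) ->
    arrs s' aarc (x * n + y) = 0.
  have : Q (regs s1 rn) (run p s1).
    apply: run_for_ind => // [x y|j s2 jlt yj fr2 IH2 x y].
      by rewrite ltn0 andbF orbF => xlt; exact: (IH x xlt).2.
    rewrite runE /= (fr2.2 arow _ isT) (fr2.1 rx isT) yj.
    have -> : regs s1 rx = i by exact: xi.
    rewrite sn in ilt; rewrite s1n in jlt; rewrite s1r // cell_inj //.
    by case: ifP => // xy xij; apply: IH2; lia.
  rewrite s1n => H2 x; rewrite ltnS => xi'; split; last first.
    by move=> y; rewrite H2 // ltn_ord andbT orbC -leq_eqVlt.
  rewrite /= (frame_run p s1).2 // /s1 /=.
  by case: eqP => // /eqP xni; apply: (IH x _).1; rewrite ltn_neqAle xni.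
by rewrite sn => H; split=> [x|x y]; case: (H x).
Qed.

Section Search.
Variables (B : {set 'I_n}) (u : 'I_n).
Hypothesis uR : u \in reach D v.

Let closure : {set 'I_n} :=
  fixset (out_step (fun x y => (x \in B) && arc D x y) u).

(** The invariant of the search loops: [X] is the iterate of the closure operator already contained
    in the tree, and [done] the pairs scanned in the current round. The tree may run ahead of [X],
    because a vertex added in a round may be expanded in the same round; it stays below
    [closure]. *)
Definition grown (X : {set 'I_n}) (done : rel nat) (s : store) : Prop :=
  exists H, [/\ search_tree DR B u H, dvert H \subset closure,
    holds_digraph s H, X \subset dvert H
  & forall x y : 'I_n, done x y -> x \in X -> x \in B -> arc D x y ->
      y \in dvert H].

Lemma closure_step : out_step (fun x y => (x \in B) && arc D x y) u closure = closure.
Proof. exact/fixsetK/out_step_mono. Qed.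

Lemma closure_arc (x y : 'I_n) :
  x \in closure -> x \in B -> arc D x y -> y \in closure.
Proof.
move=> xC xB xy; rewrite -closure_step !inE; apply/orP; right.
by apply/exists_inP; exists x => //; rewrite xB.
Qed.

Lemma run_pattach (X : {set 'I_n}) (done : rel nat) (s : store) (x y : 'I_n) :
  env s -> (forall z : 'I_n, arrs s aB z = (z \in B)) ->
  regs s rx = x -> regs s ry = y -> grown X done s ->
  grown X (fun a b => done a b || (a == x) && (b == y)) (run pattach s).
Proof.
move=> [_ sa sr] sB Ex Ey [H [tH HC hH XH doneH]].
have Ecell : eval s (cell rx ry) = x * n + y by rewrite /= Ex Ey sr.
have EVx : eval s (EGet avert (EReg rx)) = (x \in dvert H) by rewrite /= Ex hH.1.
have EVy : eval s (EGet avert (EReg ry)) = (y \in dvert H) by rewrite /= Ey hH.1.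
have EBx : eval s (EGet aB (EReg rx)) = (x \in B) by rewrite /= Ex sB.
have Exy : eval s (EGet aadj (cell rx ry)) = arc D x y.
  by rewrite [LHS]/= -[_ + _]/(eval s (cell rx ry)) Ecell sa.
(* When nothing is attached, the pair makes no open demand: either its arc is not to be followed, or
   its head is already in the tree. *)
have idle : [|| x \notin dvert H, x \notin B, ~~ arc D x y | y \in dvert H] ->
    grown X (fun a b => done a b || (a == x) && (b == y)) s.
  move=> no; exists H; split=> // a b /orP[|/andP[/eqP/val_inj-> /eqP/val_inj->]].
    exact: doneH.
  move=> xX xB xy; move: no; rewrite (subsetP XH _ xX) xB xy.
  by [].
rewrite /pattach !runE EVx EVy EBx Exy !nat_bool_neq0.
have [xH|xH] := boolP (x \in dvert H); last by apply: idle; rewrite xH.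
have [xB|xB] := boolP (x \in B); last by apply: idle; rewrite xB orbT.
have [xy|xy] := boolP (arc D x y); last by apply: idle; rewrite xy !orbT.
have [yH|yH] := boolP (y \in dvert H); first by apply: idle; rewrite yH !orbT.
have xR : x \in reach D v by apply: subsetP xH; apply: search_tree_sub_reach tH.
exists (attach xH yH); split.
- by apply: search_tree_attach tH xB _; rewrite arc_reach.
- rewrite subUset sub1set HC andbT; apply: closure_arc xB xy.
  exact: subsetP xH.
- rewrite [eval _ (cell _ _)]Ecell; split=> [z|a b] /=.
    by rewrite Ey !inE hH.1 -(inj_eq val_inj); case: eqP.
  rewrite cell_inj // arc_attach xpair_eqE -!(inj_eq val_inj) hH.2.
  by case: (_ && _).
- by apply: subset_trans XH _; apply: subsetUr.
- move=> a b /orP[|/andP[_ /eqP/val_inj->]]; last by rewrite !inE eqxx.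
  by move=> ab aX aB' ab'; rewrite !inE (doneH _ _ ab aX aB' ab') orbT.
Qed.

Lemma grown_sub (X : {set 'I_n}) (done done' : rel nat) (s : store) :
  (forall x y : 'I_n, done' x y -> done x y) ->
  grown X done s -> grown X done' s.
Proof.
by move=> dd [H [? ? ? ? doneH]]; exists H; split=> // x y /dd; apply: doneH.
Qed.

(** Once all pairs are scanned, every head of an allowed arc from [X] is in the tree, so one round
    advances [X] by at least one closure step. *)
Lemma run_pround (X : {set 'I_n}) (s : store) :
  env s -> (forall z : 'I_n, arrs s aB z = (z \in B)) -> grown X (fun _ _ => false) s ->
  grown (out_step (fun x y => (x \in B) && arc D x y) u X) (fun _ _ => false)
    (run (PFor rx (PFor ry pattach)) s).
Proof.
move=> es sB gs; have [sn _ _] := es.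
have : grown X (fun a _ => a < regs s rn) (run (PFor rx (PFor ry pattach)) s).
  apply: (run_for_ind (P := fun i => grown X (fun a _ => a < i))) => //.
  move=> i s1 ilt xi fr1 g1; rewrite sn in ilt.
  have e1 : env s1 by apply: env_frame fr1 _ _ _ es.
  have [s1n _ _] := e1.
  suff : grown X (fun a b => (a < i) || (a == i) && (b < regs s1 rn))
           (run (PFor ry pattach) s1).
    by apply: grown_sub => a b; rewrite s1n ltn_ord andbT ltnS orbC -leq_eqVlt.
  apply: (run_for_ind (P := fun j =>
    grown X (fun a b => (a < i) || (a == i) && (b < j)))) => //.
    by apply: grown_sub g1 => a b; rewrite ltn0 andbF orbF.
  move=> j s2 jlt yj fr2 g2; rewrite s1n in jlt.
  have e2 : env s2 by apply: env_frame fr2 _ _ _ e1.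
  suff : grown X (fun a b => (a < i) || (a == i) && (b < j)
      || (a == Ordinal ilt) && (b == Ordinal jlt)) (run pattach s2).
    by apply: grown_sub => a b /=; lia.
  apply: run_pattach g2 => // [z|]; first by rewrite fr2.2 // fr1.2.
  by rewrite fr2.1.
rewrite sn => -[H [tH HC hH XH doneH]]; exists H; split=> //.
rewrite subUset sub1set; apply/andP; split; first by case: tH.
apply/subsetP => y; rewrite inE => /exists_inP[x xX /andP[xB xy]].
exact: doneH xy.
Qed.

(** After n rounds the tree contains the n-th iterate from the empty set, which is already the least
    fixed point; as the tree also stays below it, the two agree and the tree is closed. *)
Lemma run_pgrow (s : store) :
  env s -> (forall z : 'I_n, arrs s aB z = (z \in B)) -> regs s rroot = u ->
  exists H, [/\ search_tree DR B u H, search_closed D B (dvert H)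
    & holds_digraph (run pgrow s) H].
Proof.
move=> es sB Eu; rewrite /pgrow !runE; have [V0 A0] := run_pclear es.
have frc := frame_run pclear s; have ec := env_frame frc isT isT isT es.
set s1 := set_arr _ _ _ _.
have e1 : env s1 by apply: env_frame (@frame_set_arr [::] [:: avert] _ _ _ _ _) _ _ _ ec.
have [s1n _ _] := e1.
have B1 (z : 'I_n) : arrs s1 aB z = (z \in B) by rewrite -sB -(frc.2 aB z isT).
have : grown (iter (regs s1 rn) (out_step (fun x y => (x \in B) && arc D x y) u) set0)
    (fun _ _ => false) (run (PFor rround (PFor rx (PFor ry pattach))) s1).
  apply: (run_for_ind (P := fun j => grown (iter j
    (out_step (fun x y => (x \in B) && arc D x y) u) set0) (fun _ _ => false))) => //.
    exists (single u); split=> //; last exact: sub0set.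
    - by apply: search_tree_single; rewrite dvert_reach.
    - by rewrite sub1set -closure_step !inE eqxx.
    - rewrite /s1 [eval _ _]/= (frc.1 rroot isT) Eu; split=> [z|x y] /=.
        by rewrite V0 inE -(inj_eq val_inj); case: eqP.
      by rewrite A0 /arc inE.
  move=> j s2 jlt _ fr2 g2.
  by apply: run_pround g2 => [|z]; [apply: env_frame fr2 _ _ _ e1 | rewrite fr2.2].
rewrite s1n => -[H [tH HC hH XH _]]; exists H; split=> // x y.
have -> : dvert H = closure.
  by apply/eqP; rewrite eqEsubset HC /closure /fixset card_ord.
exact: closure_arc.
Qed.

Lemma card_ltnS (A : {set 'I_n}) (y : 'I_n) :
  #|[set z in A | z < y.+1]| = #|[set z in A | z < y]| + (y \in A).
Proof.
rewrite (cardsD1 y) !inE leqnn andbT addnC; congr (_ + _); apply: eq_card => z.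
by rewrite !inE andbCA -(inj_eq val_inj) ltnS (ltn_neqAle z y).
Qed.

Lemma run_pcount (s : store) (W : {set 'I_n}) :
  regs s rn = n -> (forall z : 'I_n, arrs s avert z = (z \in W)) ->
  (forall z : 'I_n, arrs s aB z = (z \in B)) ->
  regs (run pcount s) rcount = #|W :\: B|.
Proof.
move=> sn sW sB; rewrite /pcount !runE; set s0 := set_reg _ _ _; set p := PFor _ _.
pose P i s' := regs s' rcount = #|[set z in W :\: B | z < i]|.
have : P (regs s0 rn) (run p s0).
  apply: run_for_ind => //.
    by rewrite /P /=; apply/esym/eqP; rewrite cards_eq0; apply/eqP/setP => z; rewrite !inE andbF.
  move=> i s1 ilt yi fr P1; rewrite [regs s0 rn]sn in ilt.
  rewrite /P (card_ltnS _ (Ordinal ilt)) !inE !runE /= yi.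
  rewrite (fr.2 avert _ isT) (fr.2 aB _ isT) (sW (Ordinal ilt)) (sB (Ordinal ilt)).
  rewrite !nat_bool_neq0; rewrite /P in P1.
  by case: (_ \in W); case: (_ \in B); rewrite /= P1 ?addn0.
rewrite /P [regs s0 rn]sn => ->; apply: eq_card => z.
by rewrite !inE ltn_ord andbT.
Qed.

End Search.

(** The store [s'] is the one reached just before the final test. The expression [allowed] has to
    decide membership in [B] only in stores that differ from [s] in the listed cells, so it may read
    levels and outer counters. *)
Lemma run_ptry (root allowed : expr) (next : prog) (B : {set 'I_n}) (u : 'I_n)
    (s : store) :
  u \in reach D v -> env s -> regs s rk = k -> eval s root = u ->
  (forall (x : 'I_n) s', regs s' rx = x -> frame [:: rroot; rx] [:: aB] s s' ->
     eval s' allowed = (x \in B)) ->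
  exists H s', [/\ search_tree DR B u H, search_closed D B (dvert H),
    holds_digraph s' H,
    frame [:: rroot; rround; rx; ry; rcount] [:: avert; aarc; aB] s s'
  & run (ptry root allowed next) s =
    if #|dvert H :\: B| < k then run next s' else set_reg s' rfound 1].
Proof.
move=> uR es sk Eu EB; rewrite /ptry; set p := PFor rx _.
rewrite -[run _ s]/(run (PIf (ELt (EReg rcount) (EReg rk)) next
  (PSet rfound (ECst 1))) (run pcount (run pgrow (run p (set_reg s rroot (eval s root)))))).
rewrite Eu run_ifE run_setE.
have fr0 := @frame_set_reg [:: rroot; rx] [:: aB] s rroot u isT.
set s0 := set_reg _ _ _ in fr0 *; set s1 := run p s0.
have e0 : env s0 by apply: env_frame fr0 _ _ _ es.
have [s0n _ _] := e0.
have fr1 := frame_run p s0; have e1 : env s1 by apply: env_frame fr1 _ _ _ e0.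
have B1 (z : 'I_n) : arrs s1 aB z = (z \in B).
  pose Q (i m : nat) := forall x : 'I_n, i = x -> m = nat_of_bool (x \in B).
  suff /(_ z) : forall i, i < regs s0 rn -> Q i (arrs s1 aB i).
    by rewrite s0n => Qz; exact: Qz (ltn_ord z) z erefl.
  apply: run_fill => // i s' _ xi fr x ix; apply: EB; first by rewrite xi.
  by apply: frame_trans fr0 _; apply: frame_sub fr => // r; rewrite !inE => ->; rewrite orbT.
have k1 : regs s1 rk = k by rewrite (fr1.1 rk isT).
have r1 : regs s1 rroot = u by rewrite (fr1.1 rroot isT).
have [H [tH cl hH]] := run_pgrow uR e1 B1 r1.
have frg := frame_run pgrow s1; set s2 := run pgrow s1 in hH frg *.
have frn := frame_run pcount s2.
have cnt : regs (run pcount s2) rcount = #|dvert H :\: B|.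
  apply: run_pcount => [|z|z]; last by rewrite (frg.2 aB z isT).
    by rewrite (frg.1 rn isT); case: e1.
  exact: hH.1.
exists H, (run pcount s2); split=> //.
- by split=> [x|x y]; rewrite (frn.2 _ _ isT); [apply: hH.1 | apply: hH.2].
- apply: (@frame_trans _ _ _ s0); first by apply: frame_sub fr0; apply/allP.
  apply: (@frame_trans _ _ _ s1); first by apply: frame_sub fr1; apply/allP.
  apply: (@frame_trans _ _ _ s2); first by apply: frame_sub frg; apply/allP.
  by apply: frame_sub frn; apply/allP.
- by rewrite [eval _ _]/= cnt (frn.1 rk isT) (frg.1 rk isT) k1 nat_bool_neq0.
Qed.

Definition found_tree (s : store) : Prop :=
  regs s rfound = 1 /\
  exists H, [/\ out_tree DR H, k <= #|leaves H| & holds_digraph s H].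

Lemma found_search_tree (B : {set 'I_n}) (u : 'I_n) (H : digraph 'I_n) (s : store) :
  search_tree DR B u H -> holds_digraph s H -> k <= #|dvert H :\: B| ->
  found_tree (set_reg s rfound 1).
Proof.
move=> tH hH kH; split=> //; exists H; split=> //; first by case: tH.
exact: leq_trans kH (search_tree_leaves tH).
Qed.

Lemma run_plevels (s : store) :
  env s -> regs s rv = v -> regs s rk = k -> regs s rfound = 0 ->
  (forall y : 'I_n, arrs s alev y = 0) ->
  let s' := run plevels s in
  found_tree s' \/
  [/\ regs s' rfound = 0, forall y : 'I_n, arrs s' alev y = lv y
    & small_levels D v k n].
Proof.
move=> es sv sk sf sl; have [sn _ _] := es.
(* After [d] rounds without success the labels are the levels truncated at [d]: a larger level still
   reads 0. *)
pose P d s' := found_tree s' \/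
  [/\ regs s' rfound = 0,
      forall y : 'I_n, arrs s' alev y = if lv y <= d then lv y else 0
    & small_levels D v k d].
suff : P (regs s rn) (run plevels s).
  rewrite sn => -[|[f l sm]]; [by left | right; split=> // y].
  by rewrite l; have := level_le_card D v y; rewrite card_ord => ->.
apply: run_for_ind => // [|d s1 dlt d1 fr1].
  right; split=> // y; rewrite /= sl leqn0; by case: eqP => // ->.
move=> Ps; rewrite run_ifE [eval _ _]/=; case: Ps => [fs|[f1 l1 sm]].
  by left; rewrite fs.1; apply: fs.
rewrite f1 [_ != _]/=.
have e1 : env s1 by apply: env_frame fr1 _ _ _ es.
have [|||H [s2 [tH cl hH fr2 ->]]] :=
    run_ptry plabel (allowed := ELt (ECst 0) (EGet alev (EReg rx))) (root := EReg rv)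
      (B := iter d (out_step (arc D) v) set0) (root_in_reach D v) e1.
- by rewrite fr1.1.
- by rewrite /= fr1.1.
- move=> x s' xx fr; rewrite in_ball /= xx (fr.2 alev _ isT) l1.
  by case: (leqP (lv x) d); rewrite ?andbT ?andbF.
have EH : dvert H = iter d.+1 (out_step (arc D) v) set0 by apply: search_tree_ball cl.
have EHD := level_ballD D v d; rewrite -EH in EHD.
case: ltnP => kH; last by left; apply: found_search_tree tH hH kH.
rewrite EHD in kH; right; split.
- by rewrite /= (frame_run plabel s2).1 // fr2.1.
- have s2n : regs s2 rn = n by rewrite (fr2.1 rn isT); case: e1.
  have d2 : regs s2 rd = d by rewrite (fr2.1 rd isT).
  have l2 (y : 'I_n) : arrs s2 alev y = if lv y <= d then lv y else 0.
    by rewrite (fr2.2 alev _ isT).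
  (* During relabelling, vertices below [i] are truncated at [d.+1] and the others still at [d]. *)
  pose Q i s' := forall y : 'I_n,
    arrs s' alev y = if lv y <= (if y < i then d.+1 else d) then lv y else 0.
  have : Q (regs s2 rn) (run plabel s2).
    apply: run_for_ind => // i s3 ilt yi fr3 Q3 y; rewrite s2n in ilt.
    have E3 : eval s3 (EGet avert (EReg ry)) = (0 < lv (Ordinal ilt) <= d.+1).
      by rewrite /= yi (fr3.2 avert _ isT) (hH.1 (Ordinal ilt)) EH in_ball.
    have E3' : eval s3 (EGet alev (EReg ry)) =
        if lv (Ordinal ilt) <= d then lv (Ordinal ilt) else 0.
      by rewrite /= yi (Q3 (Ordinal ilt)) ltnn.
    have d3 : regs s3 rd = d by rewrite (fr3.1 rd isT).
    rewrite /plabel !runE E3 E3' nat_bool_neq0.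
    have [yi'|yi'] := eqVneq (y : nat) i; last first.
      have <- : arrs s3 alev y = if lv y <= (if y < i.+1 then d.+1 else d) then lv y else 0.
        by rewrite Q3 ltnS (leq_eqVlt y) (negbTE yi').
      by case: (_ && _); [case: (_ != 0)|]; rewrite //= yi (negbTE yi').
    have {yi'} -> : y = Ordinal ilt by apply: val_inj.
    rewrite /= leqnn; move: (Q3 (Ordinal ilt)); rewrite ltnn.
    move: (lv _) => l El; case: ifP => [/andP[l0 ld]|]; last first.
      by rewrite /= El => lF; do 2 case: ifP; lia.
    rewrite ld; have [ld'|ld'] := leqP l d.
      by rewrite -lt0n l0 /= El ld'.
    by rewrite /= yi eqxx d3; lia.
  by rewrite s2n => Qn y; rewrite /= Qn ltn_ord.
- by move=> e; rewrite ltnS leq_eqVlt => /predU1P[->|/sm].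
Qed.

Lemma run_pback (s : store) :
  env s -> regs s rk = k -> regs s rfound = 0 ->
  (forall y : 'I_n, arrs s alev y = lv y) ->
  let s' := run pback s in
  found_tree s' \/
  [/\ regs s' rfound = 0
    & forall u, u \in reach D v -> small_back_closure D v k u].
Proof.
move=> es sk sf sl; have [sn _ _] := es.
pose P d s' := found_tree s' \/
  [/\ regs s' rfound = 0
    & forall u : 'I_n, u < d -> u \in reach D v -> small_back_closure D v k u].
suff : P (regs s rn) (run pback s).
  by rewrite sn => -[|[f sm]]; [left | right; split=> // u; apply: sm].
apply: run_for_ind => // [|d s1 dlt d1 fr1]; first by right.
move=> Ps; rewrite run_ifE [eval _ _]/=; case: Ps => [fs|[f1 sm]].
  (* Once a tree is found, all later iterations skip, so it is not overwritten. *)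
  by left; rewrite fs.1; apply: fs.
rewrite f1 [_ != _]/= run_ifE.
have e1 : env s1 by apply: env_frame fr1 _ _ _ es.
rewrite sn in dlt; pose u := Ordinal dlt.
have l1 (y : 'I_n) : arrs s1 alev y = lv y by rewrite (fr1.2 alev _ isT).
have -> : eval s1 (EGet alev (EReg rd)) = lv u by rewrite /= d1 (l1 u).
have smS : (u \in reach D v -> small_back_closure D v k u) -> forall u' : 'I_n,
    u' < d.+1 -> u' \in reach D v -> small_back_closure D v k u'.
  move=> smu u'; rewrite ltnS leq_eqVlt => /predU1P[Eu|]; last exact: sm.
  by have -> : u' = u by apply: val_inj.
rewrite -lt0n level_gt0; case: ifP => uR; last first.
  by right; split=> //; apply: smS; rewrite uR.
set allowed := ELt _ _.
have [|||H [s2 [tH cl hH fr2 ->]]] :=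
    run_ptry PSkip (allowed := allowed) (root := EReg rd) (u := u)
      (B := [set x | lv u <= lv x]) uR e1.
- by rewrite fr1.1.
- by [].
- move=> x s' xx fr; rewrite inE /= xx (fr.1 rd isT) d1.
  by rewrite !(fr.2 alev _ isT) (l1 u) (l1 x) addn1 ltnS.
case: ltnP => kH; last by left; apply: found_search_tree tH hH kH.
right; split; first by rewrite /= run_skipE fr2.1.
apply: smS => _; exists (dvert H); split=> //; by case: tH.
Qed.

Lemma run_pbags (s : store) :
  env s -> (forall y : 'I_n, arrs s alev y = lv y) ->
  forall (d : nat) (y : 'I_n), d < n ->
    arrs (run pbags s) abag (d * n + y) = (y \in bag D v d).
Proof.
move=> es sl; have [sn _ _] := es.
pose P i s' := forall (d : nat) (y : 'I_n), d < i ->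
  arrs s' abag (d * n + y) = (y \in bag D v d).
suff : P (regs s rn) (run pbags s) by rewrite sn.
apply: run_for_ind => // i s1 ilt di fr1 P1; rewrite sn in ilt.
have e1 : env s1 by apply: env_frame fr1 _ _ _ es.
have [s1n _ _] := e1.
pose Q j s' := forall (d : nat) (y : 'I_n), (d < i) || (d == i) && (y < j) ->
  arrs s' abag (d * n + y) = (y \in bag D v d).
suff : Q (regs s1 rn) (run (PFor ry pbag_entry) s1).
  rewrite s1n => Qn d y dlt; rewrite /= Qn // ltn_ord andbT orbC -leq_eqVlt.
  exact: dlt.
apply: run_for_ind => // [d y|j s2 jlt yj fr2 Q2].
  by rewrite ltn0 andbF orbF; apply: P1.
rewrite s1n in jlt; pose y := Ordinal jlt.
have e2 : env s2 by apply: env_frame fr2 _ _ _ e1.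
have [s2n s2a s2r] := e2.
have l2 (z : 'I_n) : arrs s2 alev z = lv z.
  by rewrite (fr2.2 alev _ isT) (fr1.2 alev _ isT).
have d2 : regs s2 rd = i by rewrite (fr2.1 rd isT).
rewrite /pbag_entry; set p := PFor rx _; set e := ELt (ECst 2) _.
rewrite -[run _ s2]/(run (PPut abag (cell rd ry) e) (run p (run (PSet racc _) s2))).
rewrite run_setE [eval _ _]/= yj (l2 y) d2 addn1 ltnS.
set s3 := set_reg s2 _ _.
have e3 : env s3 by apply: env_frame (@frame_set_reg [:: racc] [::] _ _ _ _) _ _ _ e2.
have [s3n s3a s3r] := e3.
(* The accumulator starts as the test on the level of [y] and then takes the disjunction over the
   in-neighbours [x] scanned so far. *)
pose A m s' := regs s' racc =
  (i <= lv y) || [exists x : 'I_n, [&& x < m, arc D x y & i < lv x]].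
have : A (regs s3 rn) (run p s3).
  apply: run_for_ind => // [|m s4 mlt xm fr4 A4].
    by rewrite /A /=; case: existsP => [[x] //|_]; rewrite orbF.
  rewrite s3n in mlt; pose x := Ordinal mlt.
  have y4 : regs s4 ry = y by rewrite (fr4.1 ry isT).
  have Exy : eval s4 (EGet aadj (cell rx ry)) = arc D x y.
    by rewrite /= (fr4.2 arow _ isT) xm y4 s3r // (fr4.2 aadj _ isT) (s3a x y).
  have El : eval s4 (ELt (EReg rd) (EGet alev (EReg rx))) = (i < lv x).
    by rewrite /= (fr4.1 rd isT) xm (fr4.2 alev _ isT) [regs s3 rd]d2 [arrs s3 _ _](l2 x).
  rewrite /A !runE Exy El !nat_bool_neq0.
  have -> : [exists x : 'I_n, [&& x < m.+1, arc D x y & i < lv x]] =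
      [exists x : 'I_n, [&& x < m, arc D x y & i < lv x]] || arc D x y && (i < lv x).
    apply/existsP/orP => [[z /and3P[+ zy iz]]|[/existsP[z /and3P[zm zy iz]]|/andP[xy ix]]].
    - rewrite ltnS leq_eqVlt => /predU1P[zm|zm]; last first.
        by left; apply/existsP; exists z; rewrite zm zy.
      by right; have <- : z = x; [apply: val_inj | rewrite zy].
    - by exists z; rewrite zy iz ltnW.
    - by exists x; rewrite xy ix ltnSn.
  rewrite orbA; rewrite /A in A4.
  by case: (arc D x y); case: (i < lv x); rewrite /= ?A4 ?orbF ?orbT.
rewrite s3n => A3; have frp := frame_run p s3.
set s4 := run p s3 in A3 frp *.
have y4 : regs s4 ry = y by rewrite (frp.1 ry isT).
have d4 : regs s4 rd = i by rewrite (frp.1 rd isT).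
have l4 (z : 'I_n) : arrs s4 alev z = lv z.
  by rewrite (frp.2 alev _ isT) [LHS]l2.
have Ecell : eval s4 (cell rd ry) = i * n + y.
  by rewrite /= d4 y4 (frp.2 arow _ isT) s3r.
have Ee : eval s4 e = (y \in bag D v i).
  rewrite inE /= y4 d4 l4 A3.
  have -> : [exists x : 'I_n, [&& x < n, arc D x y & i < lv x]] =
      [exists x, arc D x y && (i < lv x)].
    by apply: eq_existsb => x; rewrite ltn_ord.
  by rewrite addn2 ltnS; case: (0 < _); case: (_ <= i.+1); case: (_ || _).
move=> d z dz; rewrite runE Ecell Ee /= cell_inj //.
case: ifP => [/andP[/eqP-> /eqP zy]|dzF]; first by have -> : z = y by apply: val_inj.
rewrite (frp.2 abag _ isT) /= Q2 //.
by rewrite /= in dzF; lia.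
Qed.

Lemma run_pback_found (s : store) : found_tree s -> found_tree (run pback s).
Proof.
move=> fs; apply: (run_for_ind (P := fun _ => found_tree)) => // d s1 _ _ _ f1.
by rewrite run_ifE [eval _ _]/= f1.1.
Qed.

Lemma found_tree_frame (R A : seq nat) (s s' : store) :
  frame R A s s' -> rfound \notin R -> avert \notin A -> aarc \notin A ->
  found_tree s -> found_tree s'.
Proof.
move=> [fr fa] fR vA aA [f [H [oH kH hH]]]; split; first by rewrite fr.
by exists H; split=> //; split=> [x|x y]; rewrite fa // ?hH.1 ?hH.2.
Qed.

Lemma run_pmain (s : store) :
  regs s rn = n -> regs s rv = v -> regs s rk = k -> regs s rfound = 0 ->
  (forall x y : 'I_n, arrs s aadj (x * n + y) = arc D x y) ->
  (forall y : 'I_n, arrs s alev y = 0) ->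
  let s' := run pmain s in
  found_tree s' \/
  [/\ regs s' rfound = 0, pd_width (bags D v) <= k ^ 3
    & holds_bags (set_reg s' 1 n) (bags D v)].
Proof.
move=> sn sv sk sf sa sl.
rewrite -[run pmain s]/(run pbags (run pback (run plevels (run prows s)))).
have fr1 := frame_run prows s; set s1 := run prows s in fr1 *.
have e1 : env s1.
  split=> [|x y|]; last exact: run_prows.
    by rewrite (fr1.1 rn isT).
  by rewrite (fr1.2 aadj _ isT).
have [||||f2|[f2 l2 sm]] := @run_plevels s1 e1.
- by rewrite (fr1.1 rv isT).
- by rewrite (fr1.1 rk isT).
- by rewrite (fr1.1 rfound isT).
- by move=> y; rewrite (fr1.2 alev _ isT).
- left; apply: found_tree_frame (frame_run pbags _) _ _ _ _ => //.
  exact: run_pback_found.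
have fr2 := frame_run plevels s1; set s2 := run plevels s1 in f2 l2 fr2 *.
have e2 : env s2 by apply: env_frame fr2 _ _ _ e1.
have k2 : regs s2 rk = k by rewrite (fr2.1 rk isT) (fr1.1 rk isT).
have [f3|[f3 back]] := run_pback e2 k2 f2 l2.
  by left; apply: found_tree_frame (frame_run pbags _) _ _ _ _.
have fr3 := frame_run pback s2; set s3 := run pback s2 in f3 fr3 *.
have e3 : env s3 by apply: env_frame fr3 _ _ _ e2.
have l3 (y : 'I_n) : arrs s3 alev y = lv y by rewrite (fr3.2 alev _ isT).
right; split; first by rewrite (frame_run pbags s3).1.
  by apply: bags_width; rewrite ?card_ord.
split; first by rewrite size_mkseq card_ord.
move=> j y; rewrite size_mkseq card_ord => jn; rewrite nth_mkseq ?card_ord //.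
exact: run_pbags.
Qed.

End Program.

(** * Running time and output of the algorithm *)

Lemma inst_store_adj (i : instance) (x y : 'I_(inst_n i)) :
  arrs (inst_store i) aadj (x * inst_n i + y) = arc (inst_D i) x y.
Proof.
have n0 : 0 < inst_n i by apply: leq_ltn_trans (ltn_ord x).
have lt_xy : x * inst_n i + y < inst_n i * inst_n i by have := ltn_ord x; have := ltn_ord y; nia.
rewrite /= lt_xy divnMDl // divn_small // addn0 modnMDl modn_small //.
congr nat_of_bool; apply/existsP/idP => [[u /existsP[w]]|xy].
  by case/and3P=> /eqP/val_inj-> /eqP/val_inj->.
by exists x; apply/existsP; exists y; rewrite !eqxx.
Qed.

Lemma leaf_or_path_polytime :
  solves_in_polytime inst_size inst_store inst_correct leaf_or_path.
Proof.
(* The two closing assignments take 6 steps; the bound is first obtained in terms of n, which is at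
   most the input size. *)
have [a [d costP]] := cost_poly pmain; exists (a + 6), d => i.
set s := inst_store i; set s' := run pmain s.
have [t ext le_t] := @exec_compile pmain s isT isT.
have n0 : 0 < inst_n i by apply: leq_ltn_trans (ltn_ord (inst_v i)).
exists (t + 6), (set_reg (set_reg s' 1 (regs s' rn)) 0 (1 - regs s' rfound)); split.
- exact: (ExSeq ext (ExSeq (ExSet 1 (EReg rn) _)
    (ExSet 0 (ESub (ECst 1) (EReg rfound)) _))).
- apply: (@leq_trans ((a + 6) * inst_n i ^ d)).
    have nd : 0 < inst_n i ^ d by rewrite expn_gt0 n0.
    by have := leq_trans le_t (costP _ n0); lia.
  rewrite leq_mul2l; apply/orP; right; have := leq_pmulr (inst_n i) n0.
  move=> le_n; case: d {costP} => [//|d]; rewrite leq_exp2r // /inst_size; lia.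
- have vD : inst_v i \in dvert (inst_D i) by rewrite inst_full inE.
  have s'n : regs s' rn = inst_n i by rewrite (frame_run pmain s).1.
  have [||||x y|y|[f hH]|[f wX hX]] := @run_pmain _ _ _ (inst_k i) vD s => //.
  + exact: inst_store_adj.
  + by left; split; first by rewrite /= f.
  right; split; first by rewrite /= f.
  exists (bags (inst_D i) (inst_v i)); split=> //.
    exact: bags_path_decomposition.
  by rewrite s'n.
Qed.

Theorem theorem4p3 :
  (forall (k : nat) (T : finType) (D : digraph T) (v : T),
     0 < k -> v \in dvert D ->
     k <= ell (induced D (reach D v)) \/
     pathwidth (underlying (induced D (reach D v))) <= k ^ 3)
  /\
  (exists c : cmd, solves_in_polytime inst_size inst_store inst_correct c).
Proof.
split; first by move=> k T D v _ vD; apply: ell_or_pathwidth.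
by exists leaf_or_path; apply: leaf_or_path_polytime.
Qed.
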